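(* Let $K\ge1$ and consider the edge-reinforced random walk with $K$ walkers $X^{(1)},\dots,X^{(K)}$ on $\mathbb Z$ (as defined in the context). Assume that it starts with an initial configuration of the weights $w(0,z)$, $z\in\mathbb Z$, such that all but finitely many of them are $1$. Then $$\mathbb P\bigl[\forall i:\ X^{(i)}\text{ is recurrent}\bigr]+\mathbb P\bigl[\forall i:\ X^{(i)}\text{ has finite range}\bigr]=1.$$
   Context: **Model ($K$ edge-reinforced walkers on $\mathbb Z$).** For $z\in\mathbb Z$, the edge $\{z,z+1\}$ is also denoted by $z$. For every $z\in\mathbb Z$ let $W_z:\{0,1,2,\dots\}\to(0,\infty)$ be a (deterministic) non-decreasing function, the reinforcement function of the edge $z$. The weight of edge $z$ at time $n$ is $w(n,z)=W_z(c(n,z))$, where $c(n,z)$ is the total number of crossings of the edge $\{z,z+1\}$ by any of the $K$ walkers up to time $n$ (so $c(0,z)=0$ and $w(0,z)=W_z(0)>0$). The initial positions $X^{(1)}_0,\dots,X^{(K)}_0\in\mathbb Z$ are arbitrary. At every time step, one of the $K$ walkers is chosen uniformly at random, independently of the history, and only this walker moves. Given the history up to time $n$, if the chosen walker $i$ is at $X^{(i)}_n=z$, it jumps to $z+1$ with probability $\frac{w(n,z)}{w(n,z-1)+w(n,z)}$ and to $z-1$ with probability $\frac{w(n,z-1)}{w(n,z-1)+w(n,z)}$. **Terminology.** Walker $i$ is *recurrent* if every integer appears infinitely often in the sequence $(X^{(i)}_n)_{n\ge0}$; it has *finite range* if only finitely many distinct integers appear in the sequence $(X^{(i)}_n)_{n\ge0}$.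 (A walker that is not selected to move stays at its position; visiting an integer at time $n$ means $X^{(i)}_n$ equals it.) *)

(* Defs.v *)
From HB Require Import structures.
From mathcomp Require Import all_boot all_order all_algebra.
From mathcomp Require Import all_classical all_reals all_analysis.

Set Implicit Arguments.
Unset Strict Implicit.
Unset Printing Implicit Defensive.

Import Order.TTheory GRing.Theory Num.Theory.

Local Open Scope classical_set_scope.
Local Open Scope ring_scope.

(* The edge {z, z + 1} of the integer line is denoted by its left endpoint z. *)
Definition crosses (z a b : int) : bool :=
  ((a == z) && (b == z + 1)) || ((a == z + 1) && (b == z)).

(* A trajectory of K walkers is x : nat -> 'I_K -> int, with x n i the position
   of walker i at time n. *)
Definition crossings (K : nat) (x : nat -> 'I_K -> int) (n : nat) (z : int)
    : nat :=
  (\sum_(m < n) \sum_(i < K) crosses z (x m i) (x m.+1 i))%N.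

Definition weight (R : realType) (K : nat) (W : int -> nat -> R)
    (x : nat -> 'I_K -> int) (n : nat) (z : int) : R :=
  W z (crossings x n z).

Definition reinforcement (R : realType) (W : int -> nat -> R) : Prop :=
  forall z, (forall k, 0 < W z k) /\ nondecreasing_seq (W z).

(* The event that, up to time n, the positions are those of x and the walkers
   selected for the moves at times 0, ..., n - 1 are c 0, ..., c (n - 1). *)
Definition history (T : Type) (K : nat)
    (X : nat -> 'I_K -> T -> int) (C : nat -> T -> 'I_K)
    (x : nat -> 'I_K -> int) (c : nat -> 'I_K) (n : nat) : set T :=
  [set t | (forall m i, (m <= n)%N -> X m i t = x m i) /\
           (forall m, (m < n)%N -> C m t = c m)].

(* X n i is the position of walker i at time n, and C n the walker selected to
   make the move from time n to time n + 1.  Histories being discrete, every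
   clause "given the history, A has probability p" is written in product form,
   P (H `&` A) = P H * p, which is vacuous when P H = 0. *)
Record reinforced_walk (d : measure_display) (T : measurableType d)
    (R : realType) (P : probability T R) (K : nat) (W : int -> nat -> R)
    (x0 : 'I_K -> int)
    (X : nat -> 'I_K -> T -> int) (C : nat -> T -> 'I_K) : Prop := {
  position_measurable : forall n i z, measurable [set t | X n i t = z] ;
  selection_measurable : forall n i, measurable [set t | C n t = i] ;
  initial_position : {ae P, forall t, forall i, X 0%N i t = x0 i} ;
  selection_uniform : forall x c n i,
    P (history X C x c n `&` [set t | C n t = i])
    = (P (history X C x c n) * (K%:R^-1)%:E)%E ;
  unselected_stay : forall n,
    {ae P, forall t, forall j, j != C n t -> X n.+1 j t = X n j t} ;
  jump_right : forall x c n i,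
    P (history X C x c n `&` [set t | C n t = i]
       `&` [set t | X n.+1 i t = x n i + 1])
    = (P (history X C x c n `&` [set t | C n t = i]) *
       (weight W x n (x n i)
        / (weight W x n (x n i - 1) + weight W x n (x n i)))%:E)%E ;
  jump_left : forall x c n i,
    P (history X C x c n `&` [set t | C n t = i]
       `&` [set t | X n.+1 i t = x n i - 1])
    = (P (history X C x c n `&` [set t | C n t = i]) *
       (weight W x n (x n i - 1)
        / (weight W x n (x n i - 1) + weight W x n (x n i)))%:E)%E }.

Definition recurrent (x : nat -> int) : Prop :=
  forall z : int, infinite_set [set n | x n = z].

Definition finite_range (x : nat -> int) : Prop := finite_set (range x).

(* Main.v *)
Require Import Defs.
From HB Require Import structures.
From mathcomp Require Import all_boot all_order all_algebra.
From mathcomp Require Import all_classical all_reals all_analysis.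
From mathcomp Require Import perm ring lra zify.

(* The inverse weights between walker j and a target y (another walker or a
   fixed site) sum to a nonnegative D which is a supermartingale until j meets
   y: the two neighbouring edges contribute increments of mean zero, and
   reinforcement can only lower D.  When j crosses a fresh edge of initial
   weight 1, the mean-zero increment has absolute value 1, so the concave
   function D / (1 + D) loses a definite amount in mean as long as D stays
   bounded.  Hence a walker crossing infinitely many fresh edges a.s. meets
   every y infinitely often: it visits every site and meets every walker
   infinitely often.

   Two walkers at the same place are exchangeable, so after each meeting of i
   and j, if one of them visits a site a at all, the probability that j does so
   first is at most 1/2.  Hence if i and j meet infinitely often and j visits a
   infinitely often, then a.s. so does i.

   If infinitely many fresh edges are crossed, some walker crosses infinitely
   many, and all walkers are recurrent; otherwise all ranges are bounded.

   All null events are obtained from one bound for the finite tree of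
   histories: a nonnegative function f on the states of an automaton reading
   the moves that does not increase in mean, and is at least 1 on B, bounds the
   probability of reaching B. *)

Set Implicit Arguments.
Unset Strict Implicit.
Unset Printing Implicit Defensive.

Import Order.TTheory GRing.Theory Num.Theory.

Local Open Scope classical_set_scope.
Local Open Scope ring_scope.

(** * The Markov chain of positions and crossing numbers *)

Section Chain.
Variables (R : realType) (K : nat) (W : int -> nat -> R).
Hypothesis hK : (0 < K)%N.
Hypothesis hW : reinforcement W.

(* The positions of the walkers and the number of crossings of every edge. *)
Definition state : Type := (('I_K -> int) * (int -> nat))%type.

(* A move is a walker together with a direction, [true] meaning to the right. *)
Definition move : finType := ('I_K * bool)%type.

Implicit Types (st : state) (mv : move) (i j : 'I_K).

Definition weight_at st z : R := W z (st.2 z).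

Definition edge st mv : int := if mv.2 then st.1 mv.1 else st.1 mv.1 - 1.

Definition target st mv : int := if mv.2 then st.1 mv.1 + 1 else st.1 mv.1 - 1.

Definition step st mv : state :=
  (fun i => if i == mv.1 then target st mv else st.1 i,
   fun z => (st.2 z + (z == edge st mv))%N).

Definition move_prob st mv : R :=
  K%:R^-1 * (weight_at st (edge st mv)
             / (weight_at st (st.1 mv.1 - 1) + weight_at st (st.1 mv.1))).

Lemma weight_at_gt0 st z : 0 < weight_at st z.
Proof. exact: (hW z).1. Qed.

Lemma weight_at_step st mv z : weight_at st z <= weight_at (step st mv) z.
Proof. by apply: (hW z).2; rewrite leq_addr. Qed.

Lemma sum_move (F : move -> R) :
  \sum_mv F mv = \sum_(i < K) (F (i, true) + F (i, false)).
Proof.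
rewrite (eq_bigr (fun mv : move => F (mv.1, mv.2))); last by case.
rewrite -(pair_bigA _ (fun i b => F (i, b))) /=; apply: eq_bigr => i _.
by rewrite big_bool.
Qed.

Lemma move_prob_ge0 st mv : 0 <= move_prob st mv.
Proof.
rewrite mulr_ge0 ?invr_ge0 ?ler0n// divr_ge0 ?ltW ?weight_at_gt0//.
by rewrite addr_gt0 ?weight_at_gt0.
Qed.

Lemma sum_move_prob st : \sum_mv move_prob st mv = 1.
Proof.
rewrite sum_move (eq_bigr (fun=> K%:R^-1)) => [|i _].
  rewrite sumr_const card_ord -(mulr_natr K%:R^-1) mulVf//.
  by rewrite pnatr_eq0 -lt0n.
rewrite /move_prob /edge /= -mulrDr.
have := weight_at_gt0 st (st.1 i - 1); have := weight_at_gt0 st (st.1 i).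
set a := weight_at _ _; set b := weight_at _ _ => a0 b0.
have ab : b + a != 0 by rewrite gt_eqF// addr_gt0.
by rewrite -mulrDl [a + b]addrC divff// mulr1.
Qed.

(* The increment of the sum of the inverse weights to the left of walker i,
   computed with the weights before the move. *)
Definition incr i st mv : R :=
  if mv.1 == i then
    (if mv.2 then 1 else -1) / weight_at st (edge st mv)
  else 0.

(** An edge is crossed with probability proportional to its weight, which the inverse weight in
    [incr] cancels: the two directions contribute equal amounts of opposite sign. *)
Lemma incr_mean i st : \sum_mv move_prob st mv * incr i st mv = 0.
Proof.
rewrite sum_move big1// => k _; rewrite /incr /=.
case: eqP => [->|_]; last by rewrite !mulr0 addr0.
rewrite /move_prob /edge /=.
have := weight_at_gt0 st (st.1 i - 1); have := weight_at_gt0 st (st.1 i).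
set a := weight_at _ _; set b := weight_at _ _ => a0 b0.
have ab : b + a != 0 by rewrite gt_eqF// addr_gt0.
have kn : (K%:R : R) != 0 by rewrite pnatr_eq0 -lt0n.
by field; rewrite ab kn !gt_eqF.
Qed.

Definition swap i j st : state := (st.1 \o tperm i j, st.2).

Definition swap_move i j mv : move := (tperm i j mv.1, mv.2).

Lemma swap_moveK i j : involutive (swap_move i j).
Proof. by case=> k b; rewrite /swap_move /= tpermK. Qed.

Lemma move_prob_swap i j st mv :
  move_prob (swap i j st) (swap_move i j mv) = move_prob st mv.
Proof. by rewrite /move_prob /edge /= !tpermK. Qed.

Lemma step_swap i j st mv :
  step (swap i j st) (swap_move i j mv) = swap i j (step st mv).
Proof.
congr pair; apply/funext => k /=; last by rewrite /edge /= tpermK.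
by rewrite -(inj_eq (@perm_inj _ (tperm i j))) tpermK /target /= !tpermK.
Qed.

(** Exchangeability: weights depend only on the total crossing numbers, so the transition law
    commutes with relabelling [i] and [j]. *)
Lemma sum_swap i j st (F : state -> R) :
  \sum_mv move_prob (swap i j st) mv * F (step (swap i j st) mv) =
  \sum_mv move_prob st mv * F (swap i j (step st mv)).
Proof.
rewrite (reindex_inj (inv_inj (@swap_moveK i j))); apply: eq_bigr => mv _.
by rewrite move_prob_swap step_swap.
Qed.

End Chain.

(** * The inverse weights between two walkers *)

Section Potential.
Variable R : realType.
Implicit Types (f g : int -> R) (u v : int).

(** The discrete antiderivative of [f] vanishing at 0, so that a sum of [f] over the edges between
    two sites is a difference of two values. *)
Definition primitive f (x : int) : R :=
  match x with
  | Posz n => \sum_(k < n) f k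
  | Negz n => - \sum_(k < n.+1) f (Negz k)
  end.

Lemma primitiveS f x : primitive f (x + 1) = primitive f x + f x.
Proof.
case: x => [n|[|n]].
- by rewrite (_ : Posz n + 1 = Posz n.+1) /= ?big_ord_recr//; lia.
- by rewrite (_ : Negz 0 + 1 = 0)// /= big_ord0 big_ord_recr big_ord0 /=; ring.
- rewrite (_ : Negz n.+1 + 1 = Negz n) /=; last by lia.
  by rewrite [in RHS]big_ord_recr /=; ring.
Qed.

Lemma primitiveB f u : primitive f (u - 1) = primitive f u - f (u - 1).
Proof. by have := primitiveS f (u - 1); rewrite subrK => ->; rewrite addrK. Qed.

Lemma ler_primitive f g u v : (forall z, f z <= g z) -> u <= v ->
  primitive f v - primitive f u <= primitive g v - primitive g u.
Proof.
move=> fg uv; have [n ->] : exists n : nat, v = u + n by exists `|v - u|%N; lia.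
elim: n => [|n IH]; first by rewrite addr0 !subrr.
rewrite (_ : u + n.+1%:Z = (u + n%:Z) + 1); last by lia.
by rewrite !primitiveS; have := fg (u + n%:Z); lra.
Qed.

Lemma primitive_mono g u v : (forall z, 0 <= g z) -> u <= v ->
  primitive g u <= primitive g v.
Proof.
move=> g0 uv; rewrite -subr_ge0; apply: le_trans (ler_primitive g0 uv).
suff z x : primitive (fun=> 0 : R) x = 0 by rewrite !z subrr.
by case: x => n /=; rewrite big1 ?oppr0.
Qed.

Definition gap f u v : R := `|primitive f u - primitive f v|.

Lemma gapC f u v : gap f u v = gap f v u.
Proof. exact: distrC. Qed.

Lemma gapE f u v : (forall z, 0 <= f z) -> v <= u ->
  gap f u v = primitive f u - primitive f v.
Proof. by move=> f0 vu; rewrite /gap ger0_norm// subr_ge0 primitive_mono. Qed.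

Lemma ler_gap f g u v : (forall z, 0 <= f z) -> (forall z, f z <= g z) ->
  gap f u v <= gap g u v.
Proof.
move=> f0 fg; have g0 z : 0 <= g z by exact: le_trans (f0 z) (fg z).
wlog vu : u v / v <= u => [H|]; last by rewrite !gapE ?ler_primitive.
by have [/H//|/ltW/H] := leP v u; rewrite gapC [leRHS]gapC.
Qed.

(* Strict concavity of x / (1 + x), in the quantitative form
   x' / (1 + x') - x / (1 + x)
     = (x' - x) / (1 + x)^2 - (x' - x)^2 / ((1 + x)^2 (1 + x')). *)
Lemma concave_gain (L x xi : R) (b : bool) : 0 <= x -> x <= L -> 0 <= x + xi ->
  (b -> `|xi| = 1) ->
  b%:R + (1 + L) ^+ 2 * (2 + L) * ((x + xi) / (1 + (x + xi))) <=
  (1 + L) ^+ 2 * (2 + L) * (x / (1 + x))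
  + (1 + L) ^+ 2 * (2 + L) / (1 + x) ^+ 2 * xi.
Proof.
move=> x0 xL y0 hb.
(* [c] dominates [(1 + x)^2 (1 + x + xi)] when [x <= L] and [xi <= 1], so the quadratic loss is at
   least 1 when [b] holds. *)
set c := (1 + L) ^+ 2 * (2 + L).
have u0 : 0 < 1 + x by lra.
have v0 : 0 < 1 + (x + xi) by lra.
have -> : c * ((x + xi) / (1 + (x + xi))) =
    c * (x / (1 + x)) + c / (1 + x) ^+ 2 * xi
    - c * xi ^+ 2 / ((1 + x) ^+ 2 * (1 + (x + xi))).
  by field; rewrite !gt_eqF.
suff : b%:R <= c * xi ^+ 2 / ((1 + x) ^+ 2 * (1 + (x + xi))) by lra.
have c0 : 0 <= c by rewrite mulr_ge0 ?sqr_ge0//; lra.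
case: b hb => [/(_ isT) xi1|_]; last first.
  rewrite mulr0n; apply: divr_ge0; first by rewrite mulr_ge0 ?sqr_ge0.
  by rewrite mulr_ge0 ?sqr_ge0// ltW.
have xi2 : xi ^+ 2 = 1 by rewrite -(@real_normK _ xi) ?num_real// xi1 expr1n.
rewrite xi2 mulr1 ler_pdivlMr ?mulr_gt0 ?exprn_gt0// mul1r.
have xile : xi <= 1 by rewrite -xi1 ler_norm.
rewrite /c; apply: ler_pM; rewrite ?sqr_ge0//; [lra| |lra].
by apply: lerXn2r; rewrite ?nnegrE; lra.
Qed.

End Potential.

(** * The inverse-weight distance as a supermartingale until the meeting *)

Section Gap.
Variables (R : realType) (K : nat) (W : int -> nat -> R).
Implicit Types (st : state K) (mv : move K) (i j : 'I_K).

(* A walker or a fixed site. *)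
Definition spot : Type := ('I_K + int)%type.

Definition spot_pos (y : spot) st : int :=
  match y with inl i => st.1 i | inr a => a end.

(** Only one walker moves, by one unit, so a strict order can become an equality but cannot be
    reversed. *)
Lemma spot_lt_step y y' st mv : spot_pos y st < spot_pos y' st ->
  spot_pos y (step st mv) <= spot_pos y' (step st mv).
Proof.
case: y => [i|a]; case: y' => [i'|a'] /= lt; rewrite /target; last exact: ltW.
- have ii : i != i' by apply: contraTneq lt => ->; rewrite ltxx.
  have [im|_] := eqVneq i mv.1; have [im'|_] := eqVneq i' mv.1.
  + by rewrite im im' eqxx in ii.
  + by rewrite -im; case: mv.2; lia.
  + by rewrite -im'; case: mv.2; lia.
  + exact: ltW.
- by have [im|_] := eqVneq i mv.1; [rewrite -im; case: mv.2|]; lia.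
- by have [im|_] := eqVneq i' mv.1; [rewrite -im; case: mv.2|]; lia.
Qed.

Hypothesis hK : (0 < K)%N.
Hypothesis hW : reinforcement W.

Definition spot_incr (y : spot) st mv : R :=
  match y with inl i => incr W i st mv | inr _ => 0 end.

Lemma spot_incr_mean y st :
  \sum_mv move_prob W st mv * spot_incr y st mv = 0.
Proof.
case: y => [i|a]; first exact: incr_mean.
by rewrite big1// => mv _; rewrite mulr0.
Qed.

Definition inv_weight st z : R := (weight_at W st z)^-1.

Lemma inv_weight_ge0 st z : 0 <= inv_weight st z.
Proof. by rewrite invr_ge0 ltW// weight_at_gt0. Qed.

Lemma inv_weight_step st mv z : inv_weight (step st mv) z <= inv_weight st z.
Proof. by rewrite lef_pV2 ?posrE ?weight_at_gt0// weight_at_step. Qed.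

Lemma primitive_step y st mv :
  primitive (inv_weight st) (spot_pos y (step st mv)) =
  primitive (inv_weight st) (spot_pos y st) + spot_incr y st mv.
Proof.
case: y => [i|a] /=; last by rewrite addr0.
rewrite /incr eq_sym /target /edge; case: eqP => [->|_]; last by rewrite addr0.
case: mv.2; first by rewrite primitiveS mul1r.
by rewrite primitiveB mulN1r.
Qed.

Definition spot_gap j y st : R :=
  gap (inv_weight st) (spot_pos (inl j) st) (spot_pos y st).

(** The change of the gap at frozen weights. The sign records the side of [y] on which [j] lies,
    which one move cannot reverse. *)
Definition gap_incr j y st mv : R :=
  (if spot_pos y st < st.1 j then 1 else -1)
  * (incr W j st mv - spot_incr y st mv).

Lemma spot_gap_ge0 j y st : 0 <= spot_gap j y st.
Proof. exact: normr_ge0. Qed.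

Lemma gap_incr_mean j y st :
  \sum_mv move_prob W st mv * gap_incr j y st mv = 0.
Proof.
rewrite /gap_incr.
under eq_bigr do rewrite mulrCA mulrBr.
by rewrite -mulr_sumr sumrB incr_mean// spot_incr_mean subrr mulr0.
Qed.

(** Reinforcement only lowers inverse weights, so the gap at the new positions is at most its value
    with the old weights, which [primitive_step] computes. *)
Lemma spot_gap_step j y st mv : st.1 j != spot_pos y st ->
  spot_gap j y (step st mv) <= spot_gap j y st + gap_incr j y st mv.
Proof.
move=> ne; apply: le_trans (ler_gap _ _ _ _) _.
- exact: inv_weight_ge0.
- exact: inv_weight_step.
rewrite /gap_incr; have [lt|ge] := ltP (spot_pos y st) (st.1 j).
- rewrite gapE; [|exact: inv_weight_ge0|exact: spot_lt_step].
  rewrite !primitive_step /spot_gap gapE ?(ltW lt)//=; first by lra.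
  exact: inv_weight_ge0.
- have {ne}ge : st.1 j < spot_pos y st by rewrite lt_neqAle ne.
  rewrite gapC gapE; [|exact: inv_weight_ge0|exact: spot_lt_step].
  rewrite !primitive_step /spot_gap gapC gapE ?(ltW ge)//=; first by lra.
  exact: inv_weight_ge0.
Qed.

(* Walker j crosses an edge of initial weight 1 that nobody crossed before. *)
Definition fresh j st mv : bool :=
  [&& mv.1 == j, st.2 (edge st mv) == 0%N & W (edge st mv) 0%N == 1].

Lemma gap_incr_fresh j y st mv : st.1 j != spot_pos y st -> fresh j st mv ->
  `|gap_incr j y st mv| = 1.
Proof.
move=> ne /and3P[mj /eqP c0 /eqP w1]; rewrite /gap_incr normrM.
(* The moving walker is [j], and [y], being apart from [j], is not that walker. *)
have -> : spot_incr y st mv = 0.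
  case: y ne => [i|a] //= ne; rewrite /incr; have [mi|//] := eqVneq mv.1 i.
  by move: ne; rewrite -mi (eqP mj) eqxx.
rewrite /incr mj /weight_at c0 w1 subr0 divr1.
by case: ifP; case: mv.2; rewrite ?normrN !normr1 mulr1.
Qed.

End Gap.

(** * Histories and supermartingale bounds *)

Section AlmostEverywhere.
Context d (T : measurableType d) (R : realType) (P : probability T R).
Implicit Types A B : set T.

Lemma le_measure_ae A B : measurable A -> measurable B ->
  {ae P, forall t, A t -> B t} -> (P A <= P B)%E.
Proof.
move=> mA mB [N [mN N0 hN]].
apply: (@le_trans _ _ (P (B `|` N))).
  apply: le_measure; rewrite ?inE//; first exact: measurableU.
  move=> t At; have [Bt|nB] := pselect (B t); [by left|right].
  by apply: hN => /(_ At).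
apply: le_trans (measureU2 _ mB mN) _.
by rewrite /= N0 adde0.
Qed.

Lemma eq_measure_ae A B : measurable A -> measurable B ->
  {ae P, forall t, A t <-> B t} -> P A = P B.
Proof.
move=> mA mB AB; apply/eqP; rewrite eq_le !le_measure_ae//.
  by apply: filterS AB => t [].
by apply: filterS AB => t [].
Qed.

Lemma ae_of_measure1 A : measurable A -> P A = 1%E -> {ae P, forall t, A t}.
Proof.
move=> mA A1; exists (~` A); split => //; first exact: measurableC.
by rewrite probability_setC// A1 subee.
Qed.

(** [E] carries no measurability; the intersection of the [U m] serves as its measurable null
    cover. *)
Lemma ae_not (E : set T) (c : R) (U : nat -> set T) :
  (forall m, measurable (U m)) -> (forall m, E `<=` U m) ->
  (forall m, (P (U m) <= (c / m.+1%:R)%:E)%E) -> {ae P, forall t, ~ E t}.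
Proof.
move=> mU EU PU; exists (\bigcap_m U m); split.
- exact: bigcap_measurableType.
- apply/eqP; rewrite eq_le measure_ge0 andbT.
  apply/lee_addgt0Pr => e e0; rewrite add0e.
  have [m hm] : exists m : nat, c / m.+1%:R <= e.
    exists (Num.truncn (`|c| / e)); rewrite ler_pdivrMr ?ltr0n//.
    rewrite mulrC -ler_pdivrMr//; apply: le_trans (ltW (truncnS_gt _)).
    by rewrite ler_wpM2r ?ler_norm// invr_ge0 ltW.
  apply: le_trans (_ : P (U m) <= _)%E; last first.
    by apply: le_trans (PU m) _; rewrite lee_fin.
  apply: le_measure; rewrite ?inE//; first exact: bigcap_measurableType.
  by move=> t; apply.
- by move=> t /= /contrapT Et m _; exact: EU.
Qed.

Lemma ae_forall_count (I : countType) (Q : I -> T -> Prop) :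
  (forall i, {ae P, forall t, Q i t}) -> {ae P, forall t, forall i, Q i t}.
Proof.
move=> hQ; pose Q' n t := if unpickle n is Some i then Q i t else True.
have : {ae P, forall t, forall n, Q' n t}.
  by apply/ae_foralln => n; rewrite /Q'; case: unpickle => [i|]; [|exact: aeW].
by apply: filterS => t h i; have := h (pickle i); rewrite /Q' pickleK.
Qed.

Lemma ae_of_eq_measure A B : measurable A -> measurable B -> A `<=` B ->
  P A = P B -> {ae P, forall t, B t -> A t}.
Proof.
move=> mA mB AB PAB; exists (B `\` A); split.
- exact: measurableD.
- rewrite measureD//; last by rewrite ltey_eq fin_num_measure.
  by rewrite setIidr//= PAB subee// fin_num_measure.
- by move=> t /= /not_implyP.
Qed.

Lemma bigcup_finType (I : finType) (F : I -> set T) :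
  \bigcup_i F i = \big[setU/set0]_(i <- index_enum I) F i.
Proof.
rewrite -bigcup_seq; congr bigcup; apply/seteqP; split=> i //= _.
by rewrite mem_index_enum.
Qed.

Lemma measure_bigcup_le (I : finType) (F : I -> set T) :
  (forall i, measurable (F i)) -> (P (\bigcup_i F i) <= \sum_i P (F i))%E.
Proof.
move=> mF; rewrite bigcup_finType; elim: index_enum => [|i r IH].
  by rewrite !big_nil measure0.
rewrite !big_cons; apply: le_trans (measureU2 _ _ _) _ => //.
  exact: bigsetU_measurable.
by rewrite /= leeD2l.
Qed.

Lemma measure_bigcup_disjoint (I : finType) (F : I -> set T) :
  (forall i, measurable (F i)) -> (forall i j t, F i t -> F j t -> i = j) ->
  P (\bigcup_i F i) = (\sum_i P (F i))%E.
Proof.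
move=> mF dF; rewrite bigcup_finType.
elim: index_enum (index_enum_uniq I) => [|i r IH] /=.
  by rewrite !big_nil measure0.
move=> /andP[ir ur]; rewrite !big_cons measureU//; last 2 first.
- exact: bigsetU_measurable.
- apply/seteqP; split=> t //= [Ft]; rewrite -bigcup_seq => -[j /= jr Fj].
  by rewrite (dF _ _ _ Ft Fj) jr in ir.
- by rewrite /= IH.
Qed.

End AlmostEverywhere.

(** * Cylinder events and the law of the sequence of moves *)

Section Cylinders.
Context d (T : measurableType d) (R : realType) (P : probability T R).
Context (K : nat) (hK : (0 < K)%N) (W : int -> nat -> R)
  (hW : reinforcement W) (x0 : 'I_K -> int)
  (X : nat -> 'I_K -> T -> int) (C : nat -> T -> 'I_K)
  (hX : reinforced_walk P W x0 X C).
Implicit Types (s : seq (move K)) (mv : move K).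

Definition start : state K := (x0, fun=> 0%N).

Definition run s : state K := foldl (@step K) start s.

Lemma run_rcons s mv : run (rcons s mv) = step (run s) mv.
Proof. by rewrite /run foldl_rcons. Qed.

Definition path s n : 'I_K -> int := (run (take n s)).1.

Definition selected s n : 'I_K := (nth (Ordinal hK, true) s n).1.

Definition cyl s : set T := history X C (path s) (selected s) (size s).

Lemma crossings_path s n z : (n <= size s)%N ->
  crossings (path s) n z = (run (take n s)).2 z.
Proof.
elim: n => [|n IH] ns; first by rewrite /crossings big_ord0 take0.
have -> : crossings (path s) n.+1 z = (crossings (path s) n z
    + \sum_(i < K) crosses z (path s n i) (path s n.+1 i))%N.
  by rewrite /crossings big_ord_recr.
rewrite (IH (ltnW ns)).
rewrite /path (take_nth (Ordinal hK, true))// run_rcons /=.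
set st := run _; set mv := nth _ _ _; congr addn.
(* Only the selected walker crosses an edge, so a single summand remains. *)
rewrite (bigD1 mv.1)//= eqxx big1 ?addn0 => [|i /negPf ->].
  rewrite /crosses /target /edge.
  move: (st.1 mv.1) => p; clear.
  by case: mv.2; congr nat_of_bool; apply/idP/idP; lia.
rewrite /crosses; move: (st.1 i) => p; clear; case: eqP => /= [->|_].
  by case: eqP => //=; lia.
by rewrite andbC; case: eqP => //= ->; case: eqP => //; lia.
Qed.

Lemma weight_path s z : weight W (path s) (size s) z = weight_at W (run s) z.
Proof. by rewrite /weight crossings_path// take_size. Qed.

Lemma path_size s : path s (size s) = (run s).1.
Proof. by rewrite /path take_size. Qed.

Lemma cyl_nil : cyl [::] = [set t | forall i, X 0%N i t = x0 i].
Proof.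
apply/seteqP; split=> t /=; first by case=> /(_ 0%N) + _ i; apply.
by move=> h; split=> // m i; rewrite leqn0 => /eqP ->; exact: h.
Qed.

Lemma cyl_rcons s mv : cyl (rcons s mv) =
  cyl s `&` [set t | C (size s) t = mv.1]
  `&` [set t | forall i, X (size s).+1 i t = (step (run s) mv).1 i].
Proof.
have tk m : (m <= size s)%N -> take m (rcons s mv) = take m s.
  by move=> ms; rewrite -cats1 takel_cat.
have sl m : (m < size s)%N -> selected (rcons s mv) m = selected s m.
  by move=> ms; rewrite /selected nth_rcons ms.
apply/seteqP; split=> t /=; rewrite /cyl /history /= size_rcons.
- move=> [hx hc]; split; first split; first split.
  + by move=> m i ms; rewrite hx ?leqW// /path tk.
  + by move=> m ms; rewrite hc ?leqW// sl.
  + by rewrite hc// /selected nth_rcons ltnn eqxx.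
  + move=> i; rewrite hx// -[RHS]/((step (run s) mv).1 i).
    by rewrite -run_rcons -path_size size_rcons.
- move=> [[[hx hc] cm] xm]; split.
  + move=> m i; rewrite leq_eqVlt => /predU1P[->|]; last first.
      by rewrite ltnS => ms; rewrite hx// /path tk.
    rewrite xm -[LHS]/((step (run s) mv).1 i).
    by rewrite -run_rcons -path_size size_rcons.
  + move=> m; rewrite ltnS leq_eqVlt => /predU1P[->|ms]; last by rewrite hc ?sl.
    by rewrite cm /selected nth_rcons ltnn eqxx.
Qed.

Lemma measurable_positions n (f : 'I_K -> int) :
  measurable [set t | forall i, X n i t = f i].
Proof.
rewrite (_ : mkset _ = \bigcap_i [set t | X n i t = f i]); last first.
  by apply/seteqP; split=> t /= h i; [move=> _; exact: h|exact: h i I].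
apply: fin_bigcap_measurable => // i _; exact: position_measurable hX _ _ _.
Qed.

Lemma measurable_cyl s : measurable (cyl s).
Proof.
elim/last_ind: s => [|s mv IH].
  by rewrite cyl_nil; exact: measurable_positions.
rewrite cyl_rcons; apply: measurableI; last exact: measurable_positions.
by apply: measurableI => //; exact: selection_measurable hX _ _.
Qed.

Lemma prob_cyl_nil : P (cyl [::]) = 1%E.
Proof.
rewrite -(probability_setT P); apply: eq_measure_ae => //.
  exact: measurable_cyl.
rewrite cyl_nil; have := initial_position hX.
by apply: filterS => t h; split.
Qed.

Lemma prob_cyl_rcons s mv :
  P (cyl (rcons s mv)) = (P (cyl s) * (move_prob W (run s) mv)%:E)%E.
Proof.
(* The other walkers stay put almost surely, so only the new position of the selected one
   matters. *)
have -> : P (cyl (rcons s mv)) =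
    P (cyl s `&` [set t | C (size s) t = mv.1]
       `&` [set t | X (size s).+1 mv.1 t = target (run s) mv]).
  have ms1 : measurable (cyl s `&` [set t | C (size s) t = mv.1]).
    apply: measurableI; first exact: measurable_cyl.
    exact: selection_measurable hX _ _.
  apply: eq_measure_ae.
  - exact: measurable_cyl.
  - by apply: measurableI => //; exact: position_measurable hX _ _ _.
  have := unselected_stay hX (size s); apply: filterS => t st.
  rewrite cyl_rcons; split=> -[[ct cm] xm]; split=> //=.
    by rewrite xm /= eqxx.
  move=> i; case: eqVneq => [->//|im]; rewrite st ?cm//.
  by case: ct => /(_ (size s) i (leqnn _)) -> _; rewrite path_size.
have := selection_uniform hX (path s) (selected s) (size s) mv.1.
rewrite -/(cyl s) => uE.
have := (jump_right hX (path s) (selected s) (size s) mv.1,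
         jump_left hX (path s) (selected s) (size s) mv.1).
rewrite -/(cyl s) !uE path_size !weight_path => -[jr jl].
rewrite /move_prob EFinM muleA /target /edge.
by case: mv.2; rewrite ?jr ?jl.
Qed.

(** Any displacement other than [+1] is read as a move to the left; [legal] singles out the points
    where this reading is faithful. *)
Definition moves (t : T) (n : nat) : move K :=
  (C n t, X n.+1 (C n t) t == X n (C n t) t + 1).

Lemma cyl_moves s t : cyl s t -> s = mkseq (moves t) (size s).
Proof.
elim/last_ind: s => [|s mv IH]//; rewrite cyl_rcons => -[[cs cm] xm].
rewrite size_rcons mkseqS -IH//; congr rcons.
rewrite /moves cm xm; case: cs => /(_ (size s) mv.1 (leqnn _)) -> _ /=.
rewrite path_size eqxx /target; case: mv {cm xm} => k [] /=; congr pair; lia.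
Qed.

Definition legal (t : T) := forall n, cyl (mkseq (moves t) n) t.

(** The move probabilities sum to 1, so the one-move extensions of a cylinder, disjoint by
    [cyl_moves], exhaust it up to a null set; and there are countably many cylinders. *)
Lemma ae_legal : {ae P, forall t, legal t}.
Proof.
apply/ae_foralln; elim=> [|n IH].
  apply: ae_of_measure1; [exact: measurable_cyl|exact: prob_cyl_nil].
have cover s : {ae P, forall t, cyl s t -> exists mv, cyl (rcons s mv) t}.
  apply: filterS (_ : {ae P, forall t,
      cyl s t -> (\bigcup_mv cyl (rcons s mv)) t}) => [t h /h [mv]|].
    by exists mv.
  apply: ae_of_eq_measure.
  - by apply: fin_bigcup_measurable => // mv _; exact: measurable_cyl.
  - exact: measurable_cyl.
  - by move=> t [mv _]; rewrite cyl_rcons => -[[]].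
  rewrite measure_bigcup_disjoint => [|mv|mv mv' t].
  - under eq_bigr do rewrite prob_cyl_rcons.
    rewrite -ge0_sume_distrr => [|mv _]; last by rewrite lee_fin move_prob_ge0.
    by rewrite sumEFin sum_move_prob// mule1.
  - exact: measurable_cyl.
  - by move=> /cyl_moves + /cyl_moves; rewrite !size_rcons => <- /rcons_inj[->].
have := ae_forall_count cover; move: IH; apply: filterS2 => t IH /(_ _ IH)[mv].
move=> h; have := cyl_moves h; rewrite size_rcons size_mkseq => e.
by rewrite -e.
Qed.

Lemma legal_position t n i : legal t ->
  X n i t = (run (mkseq (moves t) n)).1 i.
Proof.
by case/(_ n) => h _; rewrite h -?path_size size_mkseq.
Qed.

Definition state_at (t : T) n : state K := run (mkseq (moves t) n).

Lemma state_atS t n : state_at t n.+1 = step (state_at t n) (moves t n).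
Proof. by rewrite /state_at mkseqS run_rcons. Qed.

(** * Automata reading the moves, and a maximal inequality *)

Section Automaton.
Variables (A : Type) (pr : A -> state K) (astep : A -> move K -> A).
Hypothesis pr_astep : forall a mv, pr (astep a mv) = step (pr a) mv.

(** The tree of histories is cut at the first visit to [B], which plays the role of a stopping
    time. *)
Fixpoint hit (B : A -> bool) N s a : set T :=
  if B a then cyl s else
  if N is N'.+1 then \bigcup_mv hit B N' (rcons s mv) (astep a mv) else set0.

Lemma measurable_hit B N s a : measurable (hit B N s a).
Proof.
elim: N s a => [|N IH] s a /=; case: (B a) => //; try exact: measurable_cyl.
by apply: fin_bigcup_measurable.
Qed.

Lemma hitS B N s a : hit B N s a `<=` hit B N.+1 s a.
Proof.
elim: N s a => [|N IH] s a t; first by rewrite /=; case: (B a).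
rewrite /= -/(hit B N) -/(hit B N.+1); case: (B a) => // -[mv _ h].
by exists mv => //; exact: IH.
Qed.

(** A maximal inequality, by induction on the horizon. The index of [f] is the number of moves left,
    on which [round_value] depends through [race]. *)
Lemma prob_hit (B : A -> bool) (f : nat -> A -> R) :
  (forall N a, 0 <= f N a) ->
  (forall N a, \sum_mv move_prob W (pr a) mv * f N (astep a mv) <= f N.+1 a) ->
  (forall N a, B a -> 1 <= f N a) ->
  forall N s a, pr a = run s -> (P (hit B N s a) <= P (cyl s) * (f N a)%:E)%E.
Proof.
move=> f0 fS fB; elim=> [|N IH] s a pa /=; case: ifPn => [Ba|_].
- by rewrite -[leLHS]mule1 lee_wpmul2l ?lee_fin ?fB.
- by rewrite measure0 mule_ge0 ?lee_fin.
- by rewrite -[leLHS]mule1 lee_wpmul2l ?lee_fin ?fB.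
apply: le_trans (measure_bigcup_le _ _) _ => [mv|]; first exact: measurable_hit.
apply: (@le_trans _ _ (\sum_mv P (cyl s) *
    (move_prob W (pr a) mv * f N (astep a mv))%:E)%E).
  apply: lee_sum => mv _; rewrite EFinM muleA pa -prob_cyl_rcons.
  by apply: IH; rewrite pr_astep pa run_rcons.
rewrite -ge0_sume_distrr; last first.
  by move=> mv _; rewrite lee_fin mulr_ge0 ?move_prob_ge0.
by rewrite sumEFin lee_wpmul2l ?lee_fin.
Qed.

Fixpoint automaton (u : nat -> move K) m n a : A :=
  if n is n'.+1 then automaton u m.+1 n' (astep a (u m)) else a.

Lemma automatonS u m n a :
  automaton u m n.+1 a = astep (automaton u m n a) (u (m + n)%N).
Proof.
elim: n m a => [|n IH] m a; first by rewrite addn0.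
by rewrite addnS -addSn -IH.
Qed.

Lemma automaton_state t m n a : pr a = state_at t m ->
  pr (automaton (moves t) m n a) = state_at t (m + n).
Proof.
move=> ha; elim: n => [|n IH]; first by rewrite addn0.
by rewrite automatonS pr_astep IH addnS state_atS.
Qed.

Lemma hit_automaton (B : A -> bool) t m n N a : legal t -> (n <= N)%N ->
  B (automaton (moves t) m n a) -> hit B N (mkseq (moves t) m) a t.
Proof.
move=> lt; elim: n m N a => [|n IH] m N a /=.
  by case: N => [|N] _ /= ->.
case: N => // N nN h /=; case: (B a); first exact: lt.
by exists (moves t m) => //; rewrite -mkseqS; exact: IH.
Qed.

(** The bound is uniform in the horizon [N], hence holds for reaching [B l] at all, and it tends to
    0 as [l] grows. An arbitrary initial history [s] lets the automaton be started at any time. *)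
Lemma ae_not_hit (B : nat -> A -> bool) (f : nat -> nat -> A -> R) (c : R) s a :
  (forall l N a, 0 <= f l N a) ->
  (forall l N a, \sum_mv move_prob W (pr a) mv * f l N (astep a mv)
                 <= f l N.+1 a) ->
  (forall l N a, B l a -> 1 <= f l N a) ->
  pr a = run s -> (forall l N, f l N a <= c / l.+1%:R) ->
  {ae P, forall t, ~ (legal t /\ s = mkseq (moves t) (size s) /\
    forall l, exists n, B l (automaton (moves t) (size s) n a))}.
Proof.
move=> f0 fS fB pa fc.
apply: (@ae_not _ _ _ P _ c (fun l => \bigcup_N hit (B l) N s a)) => [l|l|l].
- by apply: bigcupT_measurable => N; exact: measurable_hit.
- move=> t [lt [st /(_ l)[n hn]]]; exists n => //.
  by rewrite st; apply: (hit_automaton lt (leqnn n)).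
have nd : nondecreasing_seq (fun N => hit (B l) N s a).
  by apply/nondecreasing_seqP => N; apply/subsetPset; exact: hitS.
have cv : P (hit (B l) N s a) @[N --> \oo] --> P (\bigcup_N hit (B l) N s a).
  apply: nondecreasing_cvg_mu => // [N|]; first exact: measurable_hit.
  by apply: bigcupT_measurable => N; exact: measurable_hit.
rewrite -(cvg_lim _ cv)//; apply: lime_le.
  by apply: ereal_nondecreasing_is_cvgn => m n mn; apply: le_measure;
    rewrite ?inE; [exact: measurable_hit|exact: measurable_hit|
    exact/subsetPset/nd].
apply: nearW => N /=; apply: le_trans (prob_hit (f0 l) (fS l) (fB l) _ pa) _.
apply: (@le_trans _ _ (1 * (f l N a)%:E)%E).
  by rewrite lee_wpmul2r ?lee_fin// probability_le1//; exact: measurable_cyl.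
by rewrite mul1e lee_fin.
Qed.

End Automaton.

End Cylinders.

(** * Fresh crossings before a meeting *)

Section FreshCrossings.
Context d (T : measurableType d) (R : realType) (P : probability T R).
Context (K : nat) (hK : (0 < K)%N) (W : int -> nat -> R)
  (hW : reinforcement W) (x0 : 'I_K -> int)
  (X : nat -> 'I_K -> T -> int) (C : nat -> T -> 'I_K)
  (hX : reinforced_walk P W x0 X C).
Variables (j : 'I_K) (y : spot K).
Implicit Types (st : state K) (mv : move K).

Definition apart st : bool := st.1 j != spot_pos y st.

(* A state, a number of fresh crossings by walker j, and a flag telling that j
   and y have not met so far. *)
Definition fresh_count : Type := (state K * nat * bool)%type.

Definition alive (a : fresh_count) := a.2 && apart a.1.1.

Definition fresh_step (a : fresh_count) mv : fresh_count :=
  (step a.1.1 mv, (a.1.2 + fresh W j a.1.1 mv)%N, alive a).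

Let D st : R := spot_gap W j y st.
Let L l : R := l.+1%:R.
(** With this factor, [concave_gain] keeps the number of fresh crossings plus [psi] of the gap from
    increasing in mean while the gap is at most [L l]. *)
Let psi l (x : R) := (1 + L l) ^+ 2 * (2 + L l) * (x / (1 + x)).
Let goal l := ((l + 3) ^ 4)%N.

(** A union bound: the first term controls the event that the gap exceeds [L l], the second that of
    [goal l] fresh crossings before this. *)
Definition fresh_bound l (a : fresh_count) : R :=
  D a.1.1 / L l + (a.1.2%:R + psi l (D a.1.1)) / (goal l)%:R.

(** The cap at 1 keeps the supermartingale property once the gap exceeds [L l]: there the first term
    of [fresh_bound] is at least 1. *)
Definition fresh_value l (N : nat) a : R :=
  if alive a then Num.min 1 (fresh_bound l a) else 0.

Let L_gt0 l : 0 < L l. Proof. by rewrite ltr0n. Qed.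
Let goal_gt0 l : 0 < (goal l)%:R :> R.
Proof. by rewrite ltr0n expn_gt0 addn3. Qed.

Let psi_ge0 l x : 0 <= x -> 0 <= psi l x.
Proof.
move=> h; have := L_gt0 l => L0.
by rewrite /psi; apply: mulr_ge0; [rewrite mulr_ge0 ?sqr_ge0//|
  apply: divr_ge0]; lra.
Qed.

Let psi_le l x z : 0 <= x -> x <= z -> psi l x <= psi l z.
Proof.
move=> h xz; have := L_gt0 l => L0.
rewrite /psi; apply: ler_wpM2l; first by rewrite mulr_ge0 ?sqr_ge0//; lra.
rewrite ler_pdivrMr; last by lra.
by rewrite mulrAC ler_pdivlMr; nra.
Qed.

Lemma fresh_bound_ge0 l a : 0 <= fresh_bound l a.
Proof.
have D0 : 0 <= D a.1.1 by exact: spot_gap_ge0.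
apply: addr_ge0; first by rewrite divr_ge0// ltW.
by rewrite divr_ge0 ?ler0n ?addr_ge0 ?psi_ge0.
Qed.

Lemma fresh_value_ge0 l N a : 0 <= fresh_value l N a.
Proof.
by rewrite /fresh_value; case: ifP; rewrite // le_min ler01 fresh_bound_ge0.
Qed.

Lemma fresh_bound_step l a mv : alive a -> D a.1.1 <= L l ->
  fresh_bound l (fresh_step a mv) <= fresh_bound l a +
    ((L l)^-1 + (1 + L l) ^+ 2 * (2 + L l) / (1 + D a.1.1) ^+ 2 / (goal l)%:R)
    * gap_incr W j y a.1.1 mv.
Proof.
move=> /andP[_ ap] DL; rewrite /fresh_bound /fresh_step /=.
have D0 : 0 <= D a.1.1 by exact: spot_gap_ge0.
have D0' : 0 <= D (step a.1.1 mv) by exact: spot_gap_ge0.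
have Ds := spot_gap_step hW mv ap; rewrite -/(D _) -/(D _) in Ds.
have := @concave_gain R (L l) (D a.1.1) (gap_incr W j y a.1.1 mv)
  (fresh W j a.1.1 mv) D0 DL (le_trans D0' Ds) (gap_incr_fresh ap).
rewrite -/(psi _ _) -/(psi _ _); have := psi_le l D0' Ds.
set c := _ / (1 + _) ^+ 2; set xi := gap_incr _ _ _ _ _ in Ds *.
set D1 := D (step _ _) in Ds *; set D2 := D _ in Ds *.
move=> h1 h2; rewrite natrD.
apply: (@le_trans _ _ ((D2 + xi) / L l
   + (a.1.2%:R + (psi l D2 + c * xi)) / (goal l)%:R)).
  have L0 : 0 <= (L l)^-1 by rewrite invr_ge0 ltW.
  have g0 : 0 <= (goal l)%:R^-1 :> R by rewrite invr_ge0 ltW.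
  by apply: lerD; apply: ler_wpM2r => //; lra.
by rewrite le_eqVlt; apply/orP; left; apply/eqP; ring.
Qed.

Lemma fresh_value_super l N a :
  \sum_mv move_prob W a.1.1 mv * fresh_value l N (fresh_step a mv)
  <= fresh_value l N.+1 a.
Proof.
rewrite {2}/fresh_value; case: ifPn => [al|/negPf dead]; last first.
  by rewrite big1// => mv _; rewrite /fresh_value /alive /= dead mulr0.
have le1 :
    \sum_mv move_prob W a.1.1 mv * fresh_value l N (fresh_step a mv) <= 1.
  rewrite -[leRHS](sum_move_prob hK hW a.1.1); apply: ler_sum => mv _.
  rewrite ler_piMr ?move_prob_ge0// /fresh_value; case: ifP => // _.
  by rewrite ge_min lexx.
rewrite le_min le1 /=; have [DL|DL] := leP (D a.1.1) (L l); last first.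
  apply: (le_trans le1); rewrite /fresh_bound -[leLHS]addr0 lerD//.
    by rewrite ler_pdivlMr ?mul1r ?ltW.
  have D0 : 0 <= D a.1.1 by exact: spot_gap_ge0.
  by rewrite divr_ge0 ?addr_ge0 ?psi_ge0.
pose e := (L l)^-1
  + (1 + L l) ^+ 2 * (2 + L l) / (1 + D a.1.1) ^+ 2 / (goal l)%:R.
apply: (@le_trans _ _ (\sum_mv move_prob W a.1.1 mv *
   (fresh_bound l a + e * gap_incr W j y a.1.1 mv))).
  apply: ler_sum => mv _; rewrite ler_wpM2l ?move_prob_ge0//.
  apply: le_trans (fresh_bound_step mv al DL).
  rewrite /fresh_value; case: ifP => _; last exact: fresh_bound_ge0.
  by rewrite ge_min lexx orbT.
under eq_bigr do rewrite mulrDr mulrCA.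
rewrite big_split /= -mulr_suml sum_move_prob// mul1r.
by rewrite -mulr_sumr gap_incr_mean// mulr0 addr0.
Qed.

Definition fresh_done l (a : fresh_count) := alive a && (goal l <= a.1.2)%N.

Lemma fresh_value_done l N a : fresh_done l a -> 1 <= fresh_value l N a.
Proof.
move=> /andP[al kl]; rewrite /fresh_value al le_min lexx /=.
have D0 : 0 <= D a.1.1 by exact: spot_gap_ge0.
rewrite /fresh_bound -[leLHS]add0r; apply: lerD; first exact: divr_ge0.
by rewrite ler_pdivlMr// mul1r -[leLHS]addr0 lerD ?ler_nat// psi_ge0.
Qed.

Lemma fresh_value_start l N st b :
  fresh_value l N (st, 0%N, b) <= (D st + 1) / l.+1%:R.
Proof.
have D0 : 0 <= D st by exact: spot_gap_ge0.
rewrite /fresh_value; case: ifP => _; last by rewrite divr_ge0// addr_ge0.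
rewrite ge_min; apply/orP; right; rewrite /fresh_bound /= add0r.
rewrite mulrDl lerD// mul1r ler_pdivrMr//.
have L0 := L_gt0 l; set M := L l in L0 *.
(* Here [M = l + 1]; the exponent 4 in [goal] absorbs the bound [(1 + M)^2 (2 + M)] on [psi] and a
   further factor [M]. *)
have -> : (goal l)%:R = (M + 2) ^+ 4 :> R.
  rewrite natrX; congr (_ ^+ _); rewrite /M /L natrD -natr1; ring.
have h1 : D st / (1 + D st) <= 1 by rewrite ler_pdivrMr; lra.
rewrite /psi [leRHS]mulrC -/(L l) -/M ler_pdivlMr//.
apply: (@le_trans _ _ ((1 + M) ^+ 2 * (2 + M) * 1 * M)).
  apply: ler_wpM2r; first exact: ltW.
  by apply: ler_wpM2l => //; rewrite mulr_ge0 ?sqr_ge0//; lra.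
nra.
Qed.

(** The automaton is started after each of the countably many histories, so every time [m] from
    which [j] and [y] stay apart is covered. *)
Lemma ae_apart_fresh : {ae P, forall t, legal hK x0 X C t -> forall m,
  (forall n, (m <= n)%N -> apart (state_at x0 X C t n)) ->
  exists N, forall n, (N <= n)%N ->
    ~~ fresh W j (state_at x0 X C t n) (moves X C t n)}.
Proof.
have := ae_forall_count (fun s => @ae_not_hit _ _ _ P _ hK _ hW x0 X C hX
  fresh_count (fun a => a.1.1) fresh_step (fun _ _ => erefl)
  fresh_done fresh_value _ s (run x0 s, 0%N, true)
  fresh_value_ge0 fresh_value_super fresh_value_done erefl
  (fun l N => fresh_value_start l N _ _)).
apply: filterS => t h lt m ap; apply: contrapT => /forallNP io.
apply: (h (mkseq (moves X C t) m)); split=> //.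
rewrite size_mkseq; split=> // l.
set a := (_, _, _); set au := automaton _ _ _.
have st n : (au n a).1.1 = state_at x0 X C t (m + n).
  exact: (automaton_state (pr := fun a => a.1.1)).
have al n : alive (au n a).
  elim: n => [|n IH]; first by rewrite /alive /=; have := ap m (leqnn _).
  by rewrite /alive st ap ?leq_addr// /au automatonS /= IH.
suff [n hn] : exists n, (goal l <= (au n a).1.2)%N.
  by exists n; rewrite /fresh_done al.
elim: (goal l) => [|g [n hn]]; first by exists 0%N.
have /existsNP[n' /not_implyP[nn' /negP/negPn fr]] := io (m + n)%N.
have mono p : (g <= (au (n + p)%N a).1.2)%N.
  elim: p => [|p IH]; first by rewrite addn0.
  by rewrite addnS /au automatonS /=; apply: leq_trans IH _; exact: leq_addr.
(* The automaton starts at time [m] and counts the crossing made at time [n'] one step later. *)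
exists (n' - m).+1; rewrite /au automatonS -/au /= st.
rewrite subnKC; last by lia.
by rewrite fr addn1 ltnS (_ : n' - m = n + (n' - m - n))%N//; lia.
Qed.

End FreshCrossings.

(** * Exchangeability of meeting walkers *)

Section Exchange.
Context d (T : measurableType d) (R : realType) (P : probability T R).
Context (K : nat) (hK : (0 < K)%N) (W : int -> nat -> R)
  (hW : reinforcement W) (x0 : 'I_K -> int)
  (X : nat -> 'I_K -> T -> int) (C : nat -> T -> 'I_K)
  (hX : reinforced_walk P W x0 X C).
Variables (i j : 'I_K) (a : int).
Implicit Types (st : state K) (mv : move K).

(* The probability that walker j reaches a before walker i does, a race still
   undecided after N moves being settled by a fair coin. *)
Fixpoint race N st : R :=
  if st.1 i == a then 0 else if st.1 j == a then 1 else
  if N is N'.+1 then \sum_mv move_prob W st mv * race N' (step st mv) else 2^-1.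

Lemma race_ge0 N st : 0 <= race N st.
Proof.
elim: N st => [|N IH] st /=; case: ifP => // _; case: ifP => // _.
by rewrite sumr_ge0// => mv _; rewrite mulr_ge0 ?move_prob_ge0.
Qed.

(** Relabelling swaps the two winners. Equality may fail because a tie counts for [i] in both
    labellings; an undecided race contributes one half twice. *)
Lemma race_swap N st : race N st + race N (swap i j st) <= 1.
Proof.
elim: N st => [|N IH] st /=; rewrite tpermL tpermR.
  by do 2 case: eqP => _; lra.
case: eqP => _; first by case: eqP; rewrite add0r.
case: eqP => _; first by rewrite addr0.
rewrite sum_swap -big_split /= -[leRHS](sum_move_prob hK hW st).
by apply: ler_sum => mv _; rewrite -mulrDr ler_piMr ?move_prob_ge0.
Qed.

(** A state in which [i] and [j] coincide is fixed by [swap]. *)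
Lemma race_meet N st : st.1 i = st.1 j -> race N st <= 2^-1.
Proof.
move=> ij; have := race_swap N st; suff -> : swap i j st = st by lra.
case: st ij => x c /= ij; congr pair; apply/funext => k /=.
by case: tpermP => // ->.
Qed.

(* A state, a number of rounds, a flag telling that i and j met in the current
   round, and a flag telling that i has avoided a so far.  A round ends when j
   visits a after having met i. *)
Definition rounds : Type := (state K * nat * bool * bool)%type.

Definition round_state (b : rounds) : state K := b.1.1.1.

Definition avoiding (b : rounds) : bool := b.2 && ((round_state b).1 i != a).

Definition round_step (b : rounds) mv : rounds :=
  let: (st, r, met, _) := b in
  if met then
    if st.1 j == a then (step st mv, r.+1, false, avoiding b)
    else (step st mv, r, true, avoiding b)
  else (step st mv, r, st.1 i == st.1 j, avoiding b).

Lemma round_stepE b mv :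
  round_state (round_step b mv) = step (round_state b) mv.
Proof. by case: b => [[[st r] []] v] //=; case: ifP. Qed.

(** From the meeting on, a round is survived with probability at most 1/2, whence one factor 2 per
    round; until the round ends, [race] stands for that probability. *)
Definition round_value l N (b : rounds) : R :=
  let: (st, r, met, _) := b in
  if avoiding b then (if met then 2 ^+ r.+1 * race N st else 2 ^+ r) / 2 ^+ l
  else 0.

Lemma round_value_ge0 l N b : 0 <= round_value l N b.
Proof.
case: b => [[[st r] met] v] /=; case: ifP => // _; rewrite divr_ge0//.
by case: met; rewrite ?mulr_ge0 ?race_ge0.
Qed.

Lemma round_value_super l N b :
  \sum_mv move_prob W (round_state b) mv * round_value l N (round_step b mv)
  <= round_value l N.+1 b.
Proof.
have avg (c : R) (F : move K -> R) st : (forall mv, F mv <= c) ->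
    \sum_mv move_prob W st mv * F mv <= c.
  move=> Fc; rewrite -[leRHS]mul1r -(sum_move_prob hK hW st) mulr_suml.
  by apply: ler_sum => mv _; rewrite ler_wpM2l ?move_prob_ge0.
have value_le st r v : round_value l N (st, r, false, v) <= 2 ^+ r / 2 ^+ l.
  by rewrite /=; case: ifP => // _; rewrite divr_ge0.
have value_met st r v :
    round_value l N (st, r, true, v) <= 2 ^+ r.+1 / 2 ^+ l * race N st.
  rewrite /=; case: ifP => _; first by rewrite mulrAC.
  by rewrite mulr_ge0 ?divr_ge0 ?race_ge0.
case: b => [[[st r] met] v]; rewrite [leRHS]/=; case: ifPn => [av|/negPf av].
  have := av; rewrite /avoiding /round_state /= => /andP[_ ia].
  case: met av => av /=.
    rewrite (negPf ia); case: ifP => _.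
      by rewrite mulr1; apply: avg => mv; exact: value_le.
    rewrite mulrAC mulr_sumr; apply: ler_sum => mv _.
    by rewrite mulrCA ler_wpM2l ?move_prob_ge0//; exact: value_met.
  have [ij|_] := eqVneq (st.1 i) (st.1 j); last first.
    by apply: avg => mv; exact: value_le.
  (* At a meeting [race] is at most 1/2, which pays for the extra factor 2. *)
  apply: (@le_trans _ _ (2 ^+ r.+1 / 2 ^+ l * race N.+1 st)); last first.
    have h := race_meet N.+1 ij.
    have -> : 2 ^+ r.+1 / 2 ^+ l * race N.+1 st
        = 2 ^+ r / 2 ^+ l * (2 * race N.+1 st) by rewrite exprS; ring.
    by rewrite ler_piMr ?divr_ge0//; lra.
  rewrite /= (negPf ia) -ij (negPf ia) mulr_sumr; apply: ler_sum => mv _.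
  by rewrite mulrCA ler_wpM2l ?move_prob_ge0//; exact: value_met.
rewrite big1// => mv _; rewrite /=.
suff -> : round_value l N (round_step (st, r, met, v) mv) = 0 by rewrite mulr0.
by rewrite /= av; case: met {av} => //; case: ifP.
Qed.

(** The meeting flag must be down: during a round the factor [race] could bring the value below
    1. *)
Definition rounds_done l (b : rounds) : bool :=
  [&& avoiding b, ~~ b.1.2 & (l <= b.1.1.2)%N].

Lemma round_value_done l N b : rounds_done l b -> 1 <= round_value l N b.
Proof.
case: b => [[[st r] met] v] /and3P[av /negPf /= -> lr].
rewrite (_ : avoiding _ = true)//.
by rewrite ler_pdivlMr ?exprn_gt0// mul1r ler_weXn2l// ler1n.
Qed.

Lemma round_value_start l N st v :
  round_value l N (st, 0%N, false, v) <= 1 / l.+1%:R.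
Proof.
rewrite /=; case: ifP => _; last by rewrite divr_ge0.
by rewrite expr0 !div1r lef_pV2 ?posrE ?exprn_gt0// -natrX ler_nat ltn_expl.
Qed.

Lemma ae_meet_visit : {ae P, forall t, legal hK x0 X C t ->
  (forall N, exists2 n, (N <= n)%N &
     (state_at x0 X C t n).1 i = (state_at x0 X C t n).1 j) ->
  (forall N, exists2 n, (N <= n)%N & (state_at x0 X C t n).1 j = a) ->
  forall N, exists2 n, (N <= n)%N & (state_at x0 X C t n).1 i = a}.
Proof.
have := ae_forall_count (fun s => @ae_not_hit _ _ _ P _ hK _ hW x0 X C hX
  rounds round_state round_step round_stepE
  rounds_done round_value _ s (run x0 s, 0%N, false, true)
  round_value_ge0 round_value_super round_value_done erefl
  (fun l N => round_value_start l N _ _)).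
apply: filterS => t h lt meet visit m; apply: contrapT => noi.
have {}noi n : (m <= n)%N -> (state_at x0 X C t n).1 i != a.
  by move=> mn; apply/eqP => e; apply: noi; exists n.
apply: (h (mkseq (moves X C t) m)); split=> //.
rewrite size_mkseq; split=> // l.
set b := (_, _, _, _); set au := automaton _ _ _.
have st n : round_state (au n b) = state_at x0 X C t (m + n).
  exact: (automaton_state round_stepE).
have auS n : au n.+1 b = round_step (au n b) (moves X C t (m + n)).
  exact: automatonS.
have av n : avoiding (au n b).
  elim: n => [|n IH]; first by rewrite /avoiding /=; exact: noi.
  rewrite /avoiding st noi ?leq_addr// andbT auS; move: IH.
  by case: (au n b) => [[[st' r] []] v] //=; case: ifP.
suff [n /andP[mt ln]] : exists n, ~~ (au n b).1.2 && (l <= (au n b).1.1.2)%N.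
  by exists n; rewrite /rounds_done av mt.
elim: l => [|l [n /andP[mt ln]]]; first by exists 0%N.
(* First wait for a meeting. It may occur before the one supplied at time [p], hence the induction
   on the time left until [p]. *)
have [n1 /andP[mt1 ln1]] : exists n1, (au n1 b).1.2 && (l <= (au n1 b).1.1.2)%N.
  have [p np meetp] := meet (m + n)%N.
  have e : p = (m + (n + (p - m - n)))%N by lia.
  rewrite {}e in meetp; move: (p - m - n)%N meetp => q meetp.
  clear np; elim: q n mt ln meetp => [|q IH] n' mt ln meetp.
    exists n'.+1; rewrite addn0 -st in meetp; rewrite auS; move: mt ln meetp.
    by case: (au n' b) => [[[st' r] met] v] /= /negPf -> ? ->; rewrite eqxx.
  have [ij|ij] := eqVneq ((round_state (au n' b)).1 i)
                        ((round_state (au n' b)).1 j).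
    exists n'.+1; rewrite auS; move: mt ln ij.
    by case: (au n' b) => [[[st' r] met] v] /= /negPf -> ? ->; rewrite eqxx.
  rewrite addnS -addSn in meetp; apply: IH meetp; rewrite auS; move: mt ln ij.
    by case: (au n' b) => [[[st' r] met] v] /= /negPf -> ? /negPf ->.
  by case: (au n' b) => [[[st' r] met] v] /= /negPf ->.
(* In the same way, the next visit of [j] to [a] ends the round and raises the counter. *)
have [p np visp] := visit (m + n1)%N.
have e : p = (m + (n1 + (p - m - n1)))%N by lia.
rewrite {}e in visp; move: (p - m - n1)%N visp => q visp.
clear np; elim: q n1 mt1 ln1 visp => [|q IH] n' mt' ln' visp.
  exists n'.+1; rewrite addn0 -st in visp; rewrite auS; move: mt' ln' visp.
  by case: (au n' b) => [[[st' r] met] v] /= -> ? ->; rewrite eqxx.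
have [ja|ja] := eqVneq ((round_state (au n' b)).1 j) a.
  exists n'.+1; rewrite auS; move: mt' ln' ja.
  by case: (au n' b) => [[[st' r] met] v] /= -> ? ->; rewrite eqxx.
rewrite addnS -addSn in visp; apply: IH visp; rewrite auS; move: mt' ln' ja.
  by case: (au n' b) => [[[st' r] met] v] /= -> ? /negPf ->.
by case: (au n' b) => [[[st' r] met] v] /= -> ? /negPf ->.
Qed.

End Exchange.

(** * The dichotomy *)

Lemma infinite_set_natP (A : set nat) :
  infinite_set A <-> forall N, exists2 n, (N <= n)%N & A n.
Proof.
split=> [infA N|unb /finite_seqP[s As]].
  apply: contrapT => none; apply: infA.
  apply: (sub_finite_set _ (finite_II N)) => n An /=.
  by rewrite ltnNge; apply/negP => Nn; apply: none; exists n.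
have [n] := unb (\max_(k <- s) k).+1; rewrite As /= => + ns.
by rewrite ltnNge (leq_bigmax_seq (F := id)).
Qed.

Lemma finite_set_absz_le (B : nat) : finite_set [set z : int | (absz z <= B)%N].
Proof.
apply: (sub_finite_set _ (finite_image (fun n : nat => n%:Z - B%:Z)
  (finite_II (B + B).+1))) => z /= zB.
by exists (absz (z + B%:Z)) => /=; lia.
Qed.

Lemma finite_set_int_bounded (A : set int) : finite_set A ->
  exists B : nat, forall z, A z -> (absz z <= B)%N.
Proof.
move=> /finite_seqP[s ->]; exists (\max_(z <- s) absz z)%N => z /= zs.
exact: (leq_bigmax_seq (F := absz)).
Qed.

(** * Measurability of events defined by countable quantifiers *)

Section Measurability.
Context d (T : measurableType d).

Lemma measurable_exists (I : countType) (Q : I -> T -> Prop) :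
  (forall i, measurable [set t | Q i t]) ->
  measurable [set t | exists i, Q i t].
Proof.
move=> mQ; rewrite (_ : mkset _ = \bigcup_i [set t | Q i t]).
  by apply: countable_bigcupT_measurable => //; exact: countableP.
by apply/seteqP; split=> t /= [i]; [exists i|move=> _; exists i].
Qed.

Lemma measurable_forall (I : countType) (Q : I -> T -> Prop) :
  (forall i, measurable [set t | Q i t]) ->
  measurable [set t | forall i, Q i t].
Proof.
move=> mQ; rewrite (_ : mkset _ = ~` [set t | exists i, ~ Q i t]).
  apply: measurableC; apply: measurable_exists => i.
  exact: measurableC (mQ i).
apply/seteqP; split=> t /= h; first by case=> i; apply.
by move=> i; apply: contrapT => nQ; apply: h; exists i.
Qed.

Lemma measurable_discrete (V : countType) (f : T -> V) (A : set V) :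
  (forall v, measurable [set t | f t = v]) -> measurable (f @^-1` A).
Proof.
move=> mf.
rewrite (_ : _ @^-1` _ = [set t | exists v, A v /\ f t = v]).
  apply: measurable_exists => v; have [Av|nAv] := pselect (A v).
    rewrite (_ : mkset _ = [set t | f t = v])//.
    by apply/seteqP; split=> t //= [].
  by rewrite (_ : mkset _ = set0)//; apply/seteqP; split=> t //= [].
by apply/seteqP; split=> t /=; [exists (f t)|case=> v [Av ->]].
Qed.

End Measurability.

Section Dichotomy.
Context d (T : measurableType d) (R : realType) (P : probability T R).
Context (K : nat) (hK : (0 < K)%N) (W : int -> nat -> R)
  (hW : reinforcement W) (hW1 : finite_set [set z : int | W z 0%N != 1])
  (x0 : 'I_K -> int) (X : nat -> 'I_K -> T -> int) (C : nat -> T -> 'I_K)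
  (hX : reinforced_walk P W x0 X C).

(** After the last fresh crossing, no edge outside a large box can be crossed for the first time:
    its initial weight is 1, so that crossing would be fresh. *)
Lemma fresh_finite_bounded (S : nat -> state K) (u : nat -> move K) :
  S 0%N = start x0 -> (forall n, S n.+1 = step (S n) (u n)) ->
  (forall j, exists N, forall n, (N <= n)%N -> ~~ fresh W j (S n) (u n)) ->
  exists B : nat, forall n i, (absz ((S n).1 i) <= B)%N.
Proof.
move=> S0 SS /choice[N hN]; pose M := (\max_j N j)%N.
have nofresh n : (M <= n)%N -> ~~ fresh W (u n).1 (S n) (u n).
  by move=> Mn; apply: hN; apply: leq_trans Mn; exact: leq_bigmax.
have [Bw hBw] := finite_set_int_bounded hW1.
pose Bx := (\max_(n < M.+1) \max_i absz ((S n).1 i))%N.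
have hBx n i : (n <= M)%N -> (absz ((S n).1 i) <= Bx)%N.
  rewrite -ltnS => nM; apply: leq_trans (leq_bigmax (Ordinal nM)).
  exact: (leq_bigmax (F := fun i => absz ((S n).1 i))).
(* [Bx] bounds the positions up to time [M], and [Bw] the edges of initial weight other than 1. *)
pose B := (Bx + Bw).+1.
suff inv n : (forall i, (absz ((S n).1 i) <= B)%N) /\
    (forall z, (B%:Z <= z) || (z < - B%:Z) -> (S n).2 z = 0%N).
  by exists B => n; case: (inv n).
elim: n => [|n [hx hc]].
  split=> [i|z _]; last by rewrite S0.
  by rewrite leqW// (leq_trans (hBx _ _ _))// leq_addr.
have W1 z : (B%:Z <= z) || (z < - B%:Z) -> W z 0%N = 1.
  by move=> hz; apply/eqP; apply: contraTT hz => /hBw; lia.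
set e := edge (S n) (u n).
have inside : ~~ ((B%:Z <= e) || (e < - B%:Z)).
  apply/negP => he; have [Mn|nM] := leqP M n.
    have /negP := nofresh _ Mn; apply.
    by rewrite /fresh eqxx -/e hc// W1//= !eqxx.
  have := hBx n.+1 (u n).1 nM; have := hx (u n).1.
  rewrite SS /= eqxx /target; move: he; rewrite /e /edge.
  by case: (u n).2; lia.
split=> [i|z hz]; rewrite SS /=.
  case: eqP => // _; have := hx (u n).1; move: inside.
  by rewrite /target /e /edge; case: (u n).2; lia.
rewrite hc// add0n; case: eqP => // ze.
by move: inside; rewrite /e -ze hz.
Qed.

Lemma ae_dichotomy : {ae P, forall t,
  (forall i, recurrent (fun n => X n i t)) \/
  (forall i, finite_range (fun n => X n i t))}.
Proof.
have apart_ae := ae_forall_count (fun jy : 'I_K * spot K =>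
  ae_apart_fresh hK hW hX jy.1 jy.2).
have visit_ae := ae_forall_count (fun ija : 'I_K * 'I_K * int =>
  ae_meet_visit hK hW hX ija.1.1 ija.1.2 ija.2).
move: apart_ae visit_ae (ae_legal hK hW hX).
apply: filterS3 => t apart_t visit_t lt.
pose S := state_at x0 X C t; pose u := moves X C t.
have XS n i : X n i t = (S n).1 i by exact: legal_position.
have [fin|/existsNP[j /forallNP fresh_j]] := pselect
  (forall j, exists N, forall n, (N <= n)%N -> ~~ fresh W j (S n) (u n)).
  right=> i; have [B hB] := fresh_finite_bounded erefl (state_atS x0 X C t) fin.
  apply: (sub_finite_set _ (finite_set_absz_le B)) => _ [n _ <-] /=.
  by rewrite XS.
(* Otherwise [j] would stay apart from [y] from time [N] on and, by [ae_apart_fresh], would make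
   only finitely many fresh crossings. *)
have meet y N : exists2 n, (N <= n)%N & (S n).1 j = spot_pos y (S n).
  apply: contrapT => none.
  have [n Nn|N' hN'] := apart_t (j, y) lt N; last exact: (fresh_j N').
  by apply/eqP => e; apply: none; exists n.
left=> i z; apply/infinite_set_natP => N.
have [n Nn nz] : exists2 n, (N <= n)%N & (S n).1 i = z.
  apply: (visit_t (i, j, z)) => // M.
    by have [n Mn e] := meet (inl i) M; exists n.
  by have [n Mn e] := meet (inr z) M; exists n.
by exists n => //=; rewrite XS.
Qed.

Lemma measurable_recurrent :
  measurable [set t | forall i, recurrent (fun n => X n i t)].
Proof.
apply: measurable_forall => i; apply: measurable_forall => z.
rewrite (_ : mkset _ = [set t | forall N, exists k, X (N + k)%N i t = z]).
  apply: measurable_forall => N; apply: measurable_exists => k.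
  exact: position_measurable hX _ _ _.
apply/seteqP; split=> t /=.
  move=> /infinite_set_natP h N; have [n Nn e] := h N.
  by exists (n - N)%N; rewrite subnKC.
move=> h; apply/infinite_set_natP => N; have [k e] := h N.
by exists (N + k)%N; rewrite ?leq_addr.
Qed.

Lemma measurable_finite_range :
  measurable [set t | forall i, finite_range (fun n => X n i t)].
Proof.
apply: measurable_forall => i.
(* A set of integers is finite if and only if it is bounded, and boundedness takes only countable
   quantifiers. *)
rewrite (_ : mkset _ = [set t | exists B, forall n, (absz (X n i t) <= B)%N]).
  apply: measurable_exists => B; apply: measurable_forall => n.
  apply: (measurable_discrete (f := X n i) [set z : int | (absz z <= B)%N]).
  by move=> z; exact: position_measurable hX _ _ _.
apply/seteqP; split=> t /=.
  move=> /finite_set_int_bounded[B hB]; exists B => n.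
  by apply: hB; exists n.
move=> [B hB]; apply: (sub_finite_set _ (finite_set_absz_le B)) => _ [n _ <-].
exact: hB.
Qed.


End Dichotomy.

Theorem theorem17 (d : measure_display) (T : measurableType d) (R : realType)
    (P : probability T R) (K : nat) (hK : (1 <= K)%N)
    (W : int -> nat -> R) (hW : reinforcement W)
    (hW1 : finite_set [set z : int | W z 0%N != 1])
    (x0 : 'I_K -> int)
    (X : nat -> 'I_K -> T -> int) (C : nat -> T -> 'I_K)
    (hX : reinforced_walk P W x0 X C) :
  (P [set t | forall i : 'I_K, recurrent (fun n => X n i t)]
   + P [set t | forall i : 'I_K, finite_range (fun n => X n i t)])%E = 1%E.
Proof.
rewrite -measureU; last 3 first.
- exact: measurable_recurrent hX.
- exact: measurable_finite_range hX.
(* As [1 <= K] there is a walker, and it cannot both stay within distance [B] of 0 and visit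
   [B.+1]. *)
- apply/seteqP; split=> t // -[/(_ (Ordinal hK)) rec /(_ (Ordinal hK)) fin].
  have /infinite_set_natP unb := rec 0.
  have [B hB] := finite_set_int_bounded fin.
  have [n e] := infinite_setN0 (rec B.+1%:Z).
  by have := hB (X n (Ordinal hK) t) (ex_intro2 _ _ n I erefl); rewrite e ltnn.
rewrite -(probability_setT P); apply: eq_measure_ae => //.
  apply: measurableU; first exact: measurable_recurrent hX.
  exact: measurable_finite_range hX.
by have := ae_dichotomy hK hW hW1 hX; apply: filterS => t h; split.
Qed.
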